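(* Let $\mathbb{F}$ be a field of characteristic different from two. (a) Let $(\mathcal{P},\circ,\{\cdot,\cdot\})$ be a transposed Poisson algebra over $\mathbb{F}$ whose Lie bracket is not identically zero. Then $\mathcal{P}$ is simple as a transposed Poisson algebra if and only if the Lie algebra $(\mathcal{P},\{\cdot,\cdot\})$ is simple. (b) Let $(\mathcal{P}=\mathcal{P}_0\oplus\mathcal{P}_1,\circ,\{\cdot,\cdot\})$ be a transposed Poisson superalgebra over $\mathbb{F}$ whose Lie superbracket is not identically zero. Then $\mathcal{P}$ is simple as a transposed Poisson superalgebra if and only if the Lie superalgebra $(\mathcal{P},\{\cdot,\cdot\})$ is simple.
   Context: A transposed Poisson algebra is a vector space $\mathcal{P}$ (of arbitrary dimension) with an associative commutative multiplication $\circ$ (not necessarily unital) and a Lie bracket $\{\cdot,\cdot\}$ such that $2x\circ\{y,z\}=\{x\circ y,z\}+\{y,x\circ z\}$ for all $x,y,z\in\mathcal{P}$. An ideal is a proper nonzero subspace $\mathcal{I}$ with $\mathcal{I}\circ\mathcal{P}\subset\mathcal{I}$ and $\{\mathcal{I},\mathcal{P}\}\subset\mathcal{I}$; $\mathcal{P}$ is simple if it contains no ideals. A transposed Poisson superalgebra is a $\mathbb{Z}_2$-graded vector space $\mathcal{P}=\mathcal{P}_0\oplus\mathcal{P}_1$ with two grading-compatible multiplications: an associative supercommutative multiplication $\circ$ and a Lie superalgebra bracket $\{\cdot,\cdot\}$ (that is, $\{x,y\}=-(-1)^{|x||y|}\{y,x\}$ and $(-1)^{|x||z|}\{\{x,y\},z\}+(-1)^{|y||x|}\{\{y,z\},x\}+(-1)^{|z||y|}\{\{z,x\},y\}=0$)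 such that $2x\circ\{y,z\}=\{x\circ y,z\}+(-1)^{|x||y|}\{y,x\circ z\}$ for all homogeneous $x,y,z$, where $|x|$ is the parity of $x$. It is simple if it contains no proper nonzero $\mathbb{Z}_2$-graded subspace $\mathcal{I}$ with $\mathcal{I}\circ\mathcal{P}\subset\mathcal{I}$ and $\{\mathcal{I},\mathcal{P}\}\subset\mathcal{I}$. A Lie (super)algebra is simple if its bracket is nonzero and it has no proper nonzero (graded) ideals. *)

(* Defs.v *)
From HB Require Import structures.
From mathcomp Require Import all_boot all_order all_algebra.

Set Implicit Arguments.
Unset Strict Implicit.
Unset Printing Implicit Defensive.

Import GRing.Theory.
Local Open Scope ring_scope.

(* The dimension is arbitrary, so subspaces are [Prop]-valued predicates rather
   than the decidable [{pred V}] to which [submod_closed] applies. *)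
Record subspace (F : fieldType) (V : lmodType F) (I : V -> Prop) : Prop := {
  subspace0 : I 0;
  subspaceP : forall (a : F) (u v : V), I u -> I v -> I (a *: u + v)
}.

Definition proper_nonzero (F : fieldType) (V : lmodType F) (I : V -> Prop) :
  Prop := (exists x, I x /\ x <> 0) /\ (exists x, ~ I x).

Definition absorbs (F : fieldType) (V : lmodType F) (op : V -> V -> V)
  (I : V -> Prop) : Prop := forall x y, I x -> I (op x y).

Definition nonzero_op (F : fieldType) (V : lmodType F) (op : V -> V -> V) :
  Prop := exists x y, op x y <> 0.

Record lie_algebra (F : fieldType) (V : lmodType F)
    (br : {bilinear V -> V -> V}) : Prop := {
  lie_alternating : forall x, br x x = 0;
  lie_jacobi : forall x y z,
    br (br x y) z + br (br y z) x + br (br z x) y = 0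
}.

Record transposed_poisson (F : fieldType) (V : lmodType F)
    (mul br : {bilinear V -> V -> V}) : Prop := {
  tp_mulA : associative mul;
  tp_mulC : commutative mul;
  tp_lie : lie_algebra br;
  tp_rule : forall x y z,
    mul x (br y z) *+ 2 = br (mul x y) z + br y (mul x z)
}.

Definition lie_ideal (F : fieldType) (V : lmodType F)
    (br : {bilinear V -> V -> V}) (I : V -> Prop) : Prop :=
  [/\ subspace I, proper_nonzero I & absorbs br I].

Definition lie_simple (F : fieldType) (V : lmodType F)
    (br : {bilinear V -> V -> V}) : Prop :=
  nonzero_op br /\ ~ (exists I : V -> Prop, lie_ideal br I).

Definition tp_ideal (F : fieldType) (V : lmodType F)
    (mul br : {bilinear V -> V -> V}) (I : V -> Prop) : Prop :=
  [/\ subspace I, proper_nonzero I, absorbs mul I & absorbs br I].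

Definition tp_simple (F : fieldType) (V : lmodType F)
    (mul br : {bilinear V -> V -> V}) : Prop :=
  ~ (exists I : V -> Prop, tp_ideal mul br I).

(* Parities are booleans ([false] even, [true] odd), added by [addb] and
   multiplied by [&&]; [G a] is the homogeneous component of parity [a], and
   V is the internal direct sum of [G false] and [G true]. *)
Record grading (F : fieldType) (V : lmodType F) (G : bool -> V -> Prop) :
    Prop := {
  grading_subspace : forall a, subspace (G a);
  grading_sum : forall x, exists x0 x1,
    [/\ G false x0, G true x1 & x = x0 + x1];
  grading_direct : forall x, G false x -> G true x -> x = 0
}.

Definition graded_op (F : fieldType) (V : lmodType F) (G : bool -> V -> Prop)
    (op : V -> V -> V) : Prop :=
  forall a b x y, G a x -> G b y -> G (a (+) b) (op x y).

Definition graded_subspace (F : fieldType) (V : lmodType F)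
    (G : bool -> V -> Prop) (I : V -> Prop) : Prop :=
  subspace I /\
  (forall x, I x -> exists x0 x1,
     [/\ I x0 /\ G false x0, I x1 /\ G true x1 & x = x0 + x1]).

Record lie_superalgebra (F : fieldType) (V : lmodType F)
    (G : bool -> V -> Prop) (br : {bilinear V -> V -> V}) : Prop := {
  slie_grading : grading G;
  slie_graded : graded_op G br;
  slie_antisym : forall a b x y, G a x -> G b y ->
    br x y = - ((-1) ^+ (a && b) *: br y x);
  slie_jacobi : forall a b c x y z, G a x -> G b y -> G c z ->
    (-1) ^+ (a && c) *: br (br x y) z + (-1) ^+ (b && a) *: br (br y z) x
      + (-1) ^+ (c && b) *: br (br z x) y = 0
}.

Record transposed_poisson_super (F : fieldType) (V : lmodType F)
    (G : bool -> V -> Prop) (mul br : {bilinear V -> V -> V}) : Prop := {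
  stp_graded : graded_op G mul;
  stp_mulA : associative mul;
  stp_mulC : forall a b x y, G a x -> G b y ->
    mul x y = (-1) ^+ (a && b) *: mul y x;
  stp_lie : lie_superalgebra G br;
  stp_rule : forall a b c x y z, G a x -> G b y -> G c z ->
    mul x (br y z) *+ 2
      = br (mul x y) z + (-1) ^+ (a && b) *: br y (mul x z)
}.

Definition slie_ideal (F : fieldType) (V : lmodType F) (G : bool -> V -> Prop)
    (br : {bilinear V -> V -> V}) (I : V -> Prop) : Prop :=
  [/\ graded_subspace G I, proper_nonzero I & absorbs br I].

Definition slie_simple (F : fieldType) (V : lmodType F) (G : bool -> V -> Prop)
    (br : {bilinear V -> V -> V}) : Prop :=
  nonzero_op br /\ ~ (exists I : V -> Prop, slie_ideal G br I).

Definition stp_ideal (F : fieldType) (V : lmodType F) (G : bool -> V -> Prop)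
    (mul br : {bilinear V -> V -> V}) (I : V -> Prop) : Prop :=
  [/\ graded_subspace G I, proper_nonzero I, absorbs mul I & absorbs br I].

Definition stp_simple (F : fieldType) (V : lmodType F) (G : bool -> V -> Prop)
    (mul br : {bilinear V -> V -> V}) : Prop :=
  ~ (exists I : V -> Prop, stp_ideal G mul br I).

(* Main.v *)
Require Import Defs.
From mathcomp Require Import all_boot all_order all_algebra.
From Stdlib Require Import Classical.
Import GRing.Theory.
Local Open Scope ring_scope.

(** An ideal of a transposed Poisson (super)algebra is an ideal of its Lie
(super)algebra, so only one direction has content: if P is simple as a
transposed Poisson superalgebra, then a proper nonzero graded Lie ideal I
cannot exist.  Ordinary algebras are superalgebras concentrated in even degree,
so it suffices to treat superalgebras.  Below, signs are omitted.

Write x.y for the product.  The compatibility rule involves the three terms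
x.{y,z}, {x.y,z}, {y,x.z}, and 2 is invertible; hence any two of them lying in a
subspace force the third into it.  This makes several auxiliary subspaces stable
under both operations, and simplicity makes each of them zero or all of P:
- the centre of the bracket is zero ([center_eq0]) and the brackets span P
  ([span_br]), since the bracket is nonzero;
- the set of k in I with k.P inside I is zero ([core_eq0]); as it contains
  {I,I}, the ideal I is abelian ([br_ideal_eq0]);
- I + I.P is all of P ([span_ideal_mul]).

The remaining ingredient is an identity.  If {i,j} = 0, the rule gives
i.{y,j} = j.{y,i} ([mul_br_swap]).  For i, j in the abelian ideal I, this lets
one move brackets between i and j and obtain
j.{x,{z,i}} = i.{z,{x,j}} ([mul_br_br_swap]): the roles of x and z are
exchanged together with those of i and j.  Antisymmetrising in x and z, the
Jacobi identity turns this into j.{{x,z},i} = - i.{{x,z},j}, whereas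
[mul_br_swap] says that the two sides without the minus sign are equal.  So
j.{{x,z},i} = 0 and, since brackets span P, I.{P,I} = 0
([mul_br_ideal_eq0]).

Finally let u be in {P,I}, which lies in I.  Then u commutes with I.  For j in I
the rule for j, u, y has j.{u,y} = 0 and {j.u,y} = 0, so {u,j.y} = 0 as well:
u commutes with I.P.  Since I + I.P = P, the element u is central, so u = 0.
Thus {P,I} = 0, the ideal I itself is central, and I = 0, a contradiction. *)

(** * Subspaces and spans *)

Section Subspaces.
Set Implicit Arguments.
Unset Strict Implicit.
Variables (F : fieldType) (V : lmodType F).
Implicit Types (J S : V -> Prop) (u v : V).

Lemma subspaceD J u v : subspace J -> J u -> J v -> J (u + v).
Proof. by move=> sJ Ju Jv; rewrite -[u]scale1r; exact: subspaceP. Qed.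

Lemma subspaceZ J a u : subspace J -> J u -> J (a *: u).
Proof.
by move=> sJ Ju; rewrite -[_ *: _]addr0; apply: subspaceP => //; exact: subspace0.
Qed.

Lemma subspaceZK J a u : subspace J -> a != 0 -> J (a *: u) -> J u.
Proof. by move=> sJ a0 /(subspaceZ a^-1 sJ); rewrite scalerA mulVf ?scale1r. Qed.

Lemma subspaceN J u : subspace J -> J u -> J (- u).
Proof. by move=> sJ Ju; rewrite -scaleN1r; exact: subspaceZ. Qed.

Lemma subspace_sign J (e : bool) u : subspace J -> J ((-1) ^+ e *: u) -> J u.
Proof. by move=> sJ; apply: subspaceZK; rewrite ?signr_eq0. Qed.

Lemma subspace_zero : subspace (fun v : V => v = 0).
Proof. by split=> [|a u v -> ->]; rewrite ?scaler0 ?addr0. Qed.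

Lemma subspace_opl (op : {bilinear V -> V -> V}) J y :
  subspace J -> subspace (fun x => J (op x y)).
Proof.
move=> sJ; split=> [|a u v Ju Jv]; first by rewrite linear0l; exact: subspace0.
by rewrite linearPl; exact: subspaceP.
Qed.

Lemma subspace_opr (op : {bilinear V -> V -> V}) J x :
  subspace J -> subspace (fun y => J (op x y)).
Proof.
move=> sJ; split=> [|a u v Ju Jv]; first by rewrite linear0r; exact: subspace0.
by rewrite linearPr; exact: subspaceP.
Qed.

Inductive span S : V -> Prop :=
| span0 : span S 0
| spanP a u v : S u -> span S v -> span S (a *: u + v).

Lemma span_min S J u : subspace J -> (forall s, S s -> J s) -> span S u -> J u.
Proof.
move=> sJ SJ; elim=> [|a s v Ss _ Jv]; first exact: subspace0.
by apply: subspaceP => //; exact: SJ.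
Qed.

Lemma mem_span S u : S u -> span S u.
Proof.
by move=> Su; rewrite -[u]scale1r -[_ *: _]addr0; apply: spanP => //; exact: span0.
Qed.

Lemma span_subspace S : subspace (span S).
Proof.
split=> [|a u v]; first exact: span0.
elim=> [|b s w Ss _ IH] Sv; first by rewrite scaler0 add0r.
by rewrite scalerDr scalerA -addrA; apply: spanP => //; exact: IH.
Qed.

End Subspaces.

(** * Graded subspaces *)

Section Graded.
Set Implicit Arguments.
Unset Strict Implicit.
Variables (F : fieldType) (V : lmodType F) (G : bool -> V -> Prop).
Hypothesis gG : grading G.
Implicit Types (I J S : V -> Prop) (u v x y : V).

Definition homogeneous u := exists a, G a u.

Lemma homogeneous_min J :
  subspace J -> (forall v, homogeneous v -> J v) -> forall u, J u.
Proof.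
move=> sJ GJ u; have [u0 [u1 [G0 G1 ->]]] := grading_sum gG u.
by apply: subspaceD => //; apply: GJ; [exists false | exists true].
Qed.

Lemma graded_min I J u :
  graded_subspace G I -> subspace J ->
  (forall v, I v -> homogeneous v -> J v) -> I u -> J u.
Proof.
move=> [_ gI] sJ IJ /gI[u0 [u1 [[I0 G0] [I1 G1] ->]]].
by apply: subspaceD => //; apply: IJ => //; [exists false | exists true].
Qed.

Lemma span_graded S :
  (forall s, S s -> homogeneous s) -> graded_subspace G (span S).
Proof.
move=> SG; split=> [|u]; first exact: span_subspace.
have sS := span_subspace S; have sG a := grading_subspace gG a.
elim=> [|a s v Ss _ [v0 [v1 [[S0 G0] [S1 G1] ->]]]].
  by exists 0, 0; rewrite addr0; do ![split => //]; exact: subspace0.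
have [[] Gs] := SG s Ss; have spS := mem_span Ss.
  exists v0, (a *: s + v1); rewrite addrCA.
  by do ![split => //]; apply: subspaceP.
exists (a *: s + v0), v1; rewrite addrA.
by do ![split => //]; apply: subspaceP.
Qed.

Lemma homogeneous_op op x y : graded_op G op ->
  homogeneous x -> homogeneous y -> homogeneous (op x y).
Proof. by move=> gop [a Gx] [b Gy]; exists (a (+) b); apply: gop. Qed.

End Graded.

(** * Transposed Poisson superalgebras *)

Section Super.
Set Implicit Arguments.
Unset Strict Implicit.
Variables (F : fieldType) (V : lmodType F) (G : bool -> V -> Prop).
Variables mul br : {bilinear V -> V -> V}.
Hypothesis char_neq2 : 2%N \notin [pchar F].
Hypothesis tpP : transposed_poisson_super G mul br.
Implicit Types (I J S : V -> Prop) (u v w x y z i j : V) (a b c : bool).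

Local Notation hom := (homogeneous G).

Let lieP := stp_lie tpP.
Let gG := slie_grading lieP.
Let gmul := stp_graded tpP.
Let gbr := slie_graded lieP.

Lemma two_neq0 : 2%:R != 0 :> F.
Proof. by apply: contra char_neq2 => F2; rewrite inE /= F2. Qed.

Lemma subspace_half J u : subspace J -> J (u *+ 2) -> J u.
Proof. by move=> sJ; rewrite -scaler_nat; apply: subspaceZK two_neq0. Qed.

Lemma hom_mul x y : hom x -> hom y -> hom (mul x y).
Proof. exact: homogeneous_op. Qed.

Lemma hom_br x y : hom x -> hom y -> hom (br x y).
Proof. exact: homogeneous_op. Qed.

(** Membership in a subspace does not see signs.  Most of the argument is
phrased through the lemmas below, with the zero subspace as the case of an
equation; parities matter only for the identities proved further down. *)
Lemma mem_mulC J x y : subspace J -> hom x -> hom y ->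
  J (mul x y) -> J (mul y x).
Proof.
move=> sJ [a Gx] [b Gy]; rewrite (stp_mulC tpP Gx Gy); exact: subspace_sign.
Qed.

Lemma mem_brC J x y : subspace J -> hom x -> hom y -> J (br x y) -> J (br y x).
Proof.
move=> sJ [a Gx] [b Gy]; rewrite (slie_antisym lieP Gx Gy) => /(subspaceN sJ).
by rewrite opprK; exact: subspace_sign.
Qed.

Lemma mem_mul_br J x y z : subspace J -> hom x -> hom y -> hom z ->
  J (br (mul x y) z) -> J (br y (mul x z)) -> J (mul x (br y z)).
Proof.
move=> sJ [a Gx] [b Gy] [c Gz] J1 J2; apply: subspace_half => //.
by rewrite (stp_rule tpP Gx Gy Gz); apply: subspaceD => //; exact: subspaceZ.
Qed.

Lemma mem_br_mull J x y z : subspace J -> hom x -> hom y -> hom z ->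
  J (mul x (br y z)) -> J (br y (mul x z)) -> J (br (mul x y) z).
Proof.
move=> sJ [a Gx] [b Gy] [c Gz] J1 J2; have R := stp_rule tpP Gx Gy Gz.
have -> : br (mul x y) z
    = mul x (br y z) *+ 2 + - ((-1) ^+ (a && b) *: br y (mul x z)).
  by rewrite R addrK.
rewrite mulr2n; apply: subspaceD => //; first exact: subspaceD.
by apply: subspaceN => //; exact: subspaceZ.
Qed.

Lemma mem_br_mulr J x y z : subspace J -> hom x -> hom y -> hom z ->
  J (mul x (br y z)) -> J (br (mul x y) z) -> J (br y (mul x z)).
Proof.
move=> sJ [a Gx] [b Gy] [c Gz] J1 J2; apply: (@subspace_sign _ _ _ (a && b)) => //.
have -> : (-1) ^+ (a && b) *: br y (mul x z)
    = mul x (br y z) *+ 2 + - br (mul x y) z.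
  by rewrite (stp_rule tpP Gx Gy Gz) addrAC subrr add0r.
rewrite mulr2n; apply: subspaceD => //; first exact: subspaceD.
exact: subspaceN.
Qed.

Section SignedIdentities.
Variables (i j : V) (a b : bool).
Hypotheses (Gi : G a i) (Gj : G b j).

(** The rule expands i.{y,j} and j.{y,i} into {i.y,j} + {y,i.j} and
{j.y,i} + {y,j.i}; their first terms agree because {y.i,j} + {i,y.j} is
2y.{i,j} = 0.  The sign is the Koszul sign of reversing i, y, j. *)
Lemma mul_br_swap y c : G c y -> br i j = 0 ->
  mul i (br y j)
    = (-1) ^+ (a && b (+) b && c (+) c && a) *: mul j (br y i).
Proof.
move=> Gy ij0; apply/eqP; rewrite -subr_eq0; apply/eqP.
apply: (subspace_half (@subspace_zero _ _)); rewrite mulrnBl scalerMnr.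
rewrite (stp_rule tpP Gi Gy Gj) (stp_rule tpP Gj Gy Gi).
have /eqP := stp_rule tpP Gy Gi Gj.
rewrite ij0 linear0r mul0rn eq_sym addr_eq0 => /eqP R.
rewrite (stp_mulC tpP Gi Gy) (stp_mulC tpP Gi Gj) (stp_mulC tpP Gj Gy).
rewrite !linearZl_LR !linearZr_LR /= R.
rewrite (slie_antisym lieP Gi (gmul Gy Gj)) scalerDr ?scalerN ?scalerA.
rewrite opprK -!signr_addb; move: (br (mul y j) i) (br y (mul j i)) => u v.
by case: (a) (b) (c) => [] [] []; rewrite /= ?expr0 ?expr1 ?scale1r ?scaleN1r subrr.
Qed.

(** The Jacobi identity, as the statement that i |-> {x,i} is an action. *)
Lemma br_br x z p q : G p x -> G q z ->
  br (br x z) i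
    = br x (br z i) - (-1) ^+ (p && q) *: br z (br x i).
Proof.
move=> Gx Gz; have := slie_jacobi lieP Gx Gz Gi.
rewrite (slie_antisym lieP (gbr Gz Gi) Gx) (slie_antisym lieP Gi Gx).
rewrite linearNl linearZl_LR /= (slie_antisym lieP (gbr Gx Gi) Gz).
rewrite !scalerN ?opprK !scalerA -!signr_addb.
move: (br (br x z) i) (br x (br z i)) (br z (br x i)) => t u v.
case: (a) (p) (q) => [] [] [] /=; rewrite ?expr0 ?expr1 ?scale1r ?scaleN1r ?opprK.
all: by rewrite -addrA => /eqP; rewrite addr_eq0 ?eqr_opp ?opprD ?opprK => /eqP.
Qed.

End SignedIdentities.

(** Both sides equal {z,i}.{x,j} up to sign: apply [mul_br_swap] to the commuting
pairs j, {z,i} and {x,j}, i. *)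
Lemma mul_br_br_swap i j x z a b p q :
  G a i -> G b j -> G p x -> G q z ->
  br j (br z i) = 0 -> br i (br x j) = 0 ->
  mul j (br x (br z i))
    = (-1) ^+ (a && b (+) (p (+) q) && (a (+) b) (+) p && q)
        *: mul i (br z (br x j)).
Proof.
move=> Gi Gj Gx Gz jzi ixj.
have zij : br (br z i) j = 0.
  by rewrite (slie_antisym lieP (gbr Gz Gi) Gj) jzi scaler0 oppr0.
have xji : br (br x j) i = 0.
  by rewrite (slie_antisym lieP (gbr Gx Gj) Gi) ixj scaler0 oppr0.
rewrite (mul_br_swap Gj (gbr Gz Gi) Gx jzi).
rewrite (stp_mulC tpP (gbr Gz Gi) (gbr Gx Gj)).
rewrite (mul_br_swap (gbr Gx Gj) Gi Gz xji) !scalerA -!signr_addb.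
by congr ((-1) ^+ nat_of_bool _ *: _); case: (a) (b) (p) (q) => [] [] [] [].
Qed.

(** The element equals i.{{x,z},j} up to the Koszul sign by [mul_br_swap], and
minus that by [mul_br_br_swap] antisymmetrised in x and z. *)
Lemma mul_br_br_eq0 i j x z : hom i -> hom j -> hom x -> hom z ->
  br i j = 0 -> (forall y, hom y -> br j (br y i) = 0) ->
  (forall y, hom y -> br i (br y j) = 0) ->
  mul j (br (br x z) i) = 0.
Proof.
move=> [a Gi] [b Gj] [p Gx] [q Gz] ij0 jPi iPj.
have ji0 : br j i = 0 by rewrite (slie_antisym lieP Gj Gi) ij0 scaler0 oppr0.
have hx : hom x by exists p.
have hz : hom z by exists q.
apply: (subspace_half (@subspace_zero _ _)); rewrite mulr2n.
(* Only the second summand is moved to i; the first keeps its place, and its two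
   Jacobi terms then cancel crosswise against those of the second. *)
rewrite {2}(mul_br_swap Gj Gi (gbr Gx Gz) ji0).
rewrite (br_br Gi Gx Gz) (br_br Gj Gx Gz) !linearBr !linearZr_LR /=.
rewrite (mul_br_br_swap Gi Gj Gx Gz (jPi _ hz) (iPj _ hx)).
rewrite (mul_br_br_swap Gi Gj Gz Gx (jPi _ hx) (iPj _ hz)).
rewrite scalerBr !scalerA -!signr_addb.
move: (mul i (br x (br z j))) (mul i (br z (br x j))) => u v.
case: (a) (b) (p) (q) => [] [] [] [] /=;
  by rewrite ?expr0 ?expr1 ?scale1r ?scaleN1r ?opprK addrA ?addrK ?subrK
             ?subrr ?addNr.
Qed.

(** * Simple transposed Poisson superalgebras *)

Section Simple.
Hypotheses (simpleP : stp_simple G mul br) (br_neq0 : nonzero_op br).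

(** The form in which simplicity is used: generators that are homogeneous make
the span graded, and stability needs checking only on generators and homogeneous
elements. *)
Lemma simple_span S :
  (forall s, S s -> hom s) ->
  (forall s y, S s -> hom y -> span S (mul s y)) ->
  (forall s y, S s -> hom y -> span S (br s y)) ->
  (exists s, S s /\ s <> 0) -> forall v, span S v.
Proof.
move=> Shom Smul Sbr [s [Ss s0]] v; have sS := span_subspace S.
have absS (op : {bilinear V -> V -> V}) :
    (forall s y, S s -> hom y -> span S (op s y)) -> absorbs op (span S).
  move=> Sop x y; apply: (span_min (subspace_opl op y sS)) => t St.
  by apply: (homogeneous_min gG (subspace_opr op t sS)) => w; exact: Sop.
apply: NNPP => Sv; apply: simpleP; exists (span S); split.
- exact: span_graded.
- by split; [exists s; split=> //; exact: mem_span | exists v].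
- exact: absS.
- exact: absS.
Qed.

Let zero_subspace := @subspace_zero F V.

(** The homogeneous central elements span an ideal: for z central, the rule for
w, z, t has w.{z,t} = 0 = {z,w.t}, so w.z is central.  The whole space is
excluded by the nonzero bracket. *)
Lemma center_eq0 z : hom z -> (forall y, hom y -> br z y = 0) -> z = 0.
Proof.
pose Z z := hom z /\ forall y, hom y -> br z y = 0.
move=> hz zP; apply: NNPP => z0; have [x [y []]] := br_neq0.
have : span Z x.
  apply: simple_span; last by exists z.
  - by move=> ? [].
  - move=> {hz zP z0} {}z w [hz zP] hw; apply: mem_span.
    split=> [|t ht]; first exact: hom_mul.
    apply: (mem_mulC (J := fun u => br u t = 0)) => //.
      exact: subspace_opl zero_subspace.
    apply: (mem_br_mull zero_subspace) => //.
      by rewrite zP ?linear0r.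
    by rewrite zP //; exact: hom_mul.
  - by move=> s w [_ sP] hw; rewrite sP //; exact: span0.
apply: (span_min (subspace_opl br y zero_subspace)) => s [_ sP].
exact: (homogeneous_min gG (subspace_opr br s zero_subspace)).
Qed.

(** The rule writes 2z.{x,y} as a sum of brackets. *)
Lemma span_br v : span (fun u => exists x y, [/\ hom x, hom y & u = br x y]) v.
Proof.
apply: simple_span v => [_ [x [y [hx hy ->]]]||_ z [x [y [hx hy ->]]] hz|].
- exact: hom_br.
- move=> _ z [x [y [hx hy ->]]] hz; have hxy := hom_br hx hy.
  have [hzx hzy] := (hom_mul hz hx, hom_mul hz hy).
  apply: (mem_mulC (span_subspace _) hz hxy).
  apply: (mem_mul_br (span_subspace _) hz hx hy); apply: mem_span.
    by exists (mul z x), y.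
  by exists x, (mul z y).
- apply: mem_span; exists (br x y), z; split=> //; exact: hom_br.
- apply: NNPP => no; have [x [y]] := br_neq0; apply.
  have s0l w := subspace_opl br w zero_subspace.
  have s0r w := subspace_opr br w zero_subspace.
  apply: (homogeneous_min gG (s0l y)) => u hu.
  apply: (homogeneous_min gG (s0r u)) => v hv.
  by apply: NNPP => uv; apply: no; exists (br u v); split=> //; exists u, v.
Qed.

Section LieIdeal.
Variable I : V -> Prop.
Hypotheses (gI : graded_subspace G I) (pI : proper_nonzero I).
Hypothesis brI : absorbs br I.

Let sI : subspace I := gI.1.

Lemma ideal_br x i : hom x -> hom i -> I i -> I (br x i).
Proof. by move=> hx hi Ii; apply: (mem_brC sI hi hx); exact: brI. Qed.

(** The elements k as in the hypotheses span an ideal inside I: for x.{k,y} use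
that x.k and k lie in I, so that both brackets in the rule do. *)
Lemma core_eq0 k : hom k -> I k -> (forall x, hom x -> I (mul k x)) -> k = 0.
Proof.
pose K k := [/\ hom k, I k & forall x, hom x -> I (mul k x)].
move=> hk Ik kI; apply: NNPP => k0; have [_ [v]] := pI; apply.
have : span K v.
  apply: simple_span; last by exists k.
  - by move=> ? [].
  - move=> s y [hs Is sI'] hy; apply: mem_span; split; [exact: hom_mul|exact: sI'|].
    by move=> x hx; rewrite -(stp_mulA tpP); apply: sI'; exact: hom_mul.
  - move=> s y [hs Is sI'] hy; apply: mem_span; split; [exact: hom_br|exact: brI|].
    move=> x hx; apply: mem_mulC => //; first exact: hom_br.
    apply: mem_mul_br => //; last exact: brI.
    by apply: brI; apply: mem_mulC => //; exact: sI'.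
by apply: span_min => // s [].
Qed.

(** By [core_eq0]: 2x.{i,j} is {x.i,j} + {i,x.j}, a sum of elements of I. *)
Lemma br_ideal_eq0 i j : hom i -> I i -> hom j -> I j -> br i j = 0.
Proof.
move=> hi Ii hj Ij; apply: core_eq0; [exact: hom_br | exact: brI |].
move=> x hx; apply: mem_mulC => //; first exact: hom_br.
apply: mem_mul_br => //; last exact: brI.
by apply: ideal_br => //; exact: hom_mul.
Qed.

Lemma nonzero_homogeneous : exists i, [/\ hom i, I i & i <> 0].
Proof.
have [[i [Ii i0]] _] := pI; apply: NNPP => no; apply: i0.
apply: (graded_min gI zero_subspace) Ii => j Ij hj.
by apply: NNPP => j0; apply: no; exists j.
Qed.

(** I + I.P is stable under the bracket because the rule expresses {j.x,z} through
{j,z}.x and {j,x.z}, the first in I.P and the second in I. *)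
Lemma span_ideal_mul v :
  span (fun u => hom u /\ (I u \/
    exists j y, [/\ hom j, hom y, I j & u = mul j y])) v.
Proof.
set S := (fun u => _); have sS := span_subspace S.
have SI i : hom i -> I i -> span S i by move=> hi Ii; apply: mem_span; split; [|left].
have SM j y : hom j -> hom y -> I j -> span S (mul j y).
  by move=> hj hy Ij; apply: mem_span; split; [exact: hom_mul | right; exists j, y].
apply: simple_span => [s []//|s y [hs sS'] hy|s z [hs sS'] hz|].
- case: sS' => [Is|[j [x [hj hx Ij ->]]]]; first exact: SM.
  by rewrite -(stp_mulA tpP); apply: SM => //; exact: hom_mul.
- case: sS' => [Is|[j [x [hj hx Ij ->]]]]; first by apply: SI; [exact: hom_br|exact: brI].
  apply: (mem_mulC (J := fun u => span S (br u z))) => //.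
    exact: subspace_opl.
  have hjz := hom_br hj hz; have hxz := hom_mul hx hz.
  apply: mem_br_mull => //.
    by apply: mem_mulC => //; apply: SM => //; exact: brI.
  by apply: SI; [exact: hom_br | exact: brI].
- by have [i [hi Ii i0]] := nonzero_homogeneous; exists i; split=> //; split; [|left].
Qed.

Lemma mul_br_ideal_eq0 i j w : hom i -> I i -> hom j -> I j ->
  mul j (br w i) = 0.
Proof.
move=> hi Ii hj Ij.
have s0 : subspace (fun w => mul j (br w i) = 0).
  exact: (subspace_opl br i (subspace_opr mul j zero_subspace)).
apply: (span_min s0) (span_br w) => _ [x [z [hx hz ->]]].
apply: mul_br_br_eq0 => // [|y hy|y hy]; apply: br_ideal_eq0 => //.
- exact: hom_br.
- exact: ideal_br.
- exact: hom_br.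
- exact: ideal_br.
Qed.

(** The element {w,i} commutes with I, which is abelian, and with I.P by
[mul_br_ideal_eq0] and the rule; these span the space. *)
Lemma ideal_central w i : hom w -> hom i -> I i -> br w i = 0.
Proof.
move=> hw hi Ii; have hwi := hom_br hw hi; have Iwi := ideal_br hw hi Ii.
apply: center_eq0 => // u _.
apply: (span_min (subspace_opr br (br w i) zero_subspace)) (span_ideal_mul u).
move=> s [hs [Is|[j [y [hj hy Ij ->]]]]]; first exact: br_ideal_eq0.
apply: (mem_br_mulr zero_subspace) => //.
  apply: (mem_brC (J := fun u => mul j u = 0)) => //.
    exact: subspace_opr zero_subspace.
  exact: mul_br_ideal_eq0.
by rewrite mul_br_ideal_eq0 // linear0l.
Qed.

Lemma no_lie_ideal : False.
Proof.
have [i [hi Ii i0]] := nonzero_homogeneous; apply: i0.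
apply: center_eq0 => // y hy; apply: (mem_brC zero_subspace) => //.
exact: ideal_central.
Qed.

End LieIdeal.
End Simple.

Lemma stp_simple_iff :
  nonzero_op br -> (stp_simple G mul br <-> slie_simple G br).
Proof.
move=> br0; split=> [simpleP|[_ simpleP] [I [gI pI _ brI]]].
  by split=> // -[I [gI pI brI]]; exact: (no_lie_ideal simpleP br0 gI pI brI).
by apply: simpleP; exists I.
Qed.

End Super.

(** * Algebras as superalgebras concentrated in even degree *)

Section TrivialGrading.
Set Implicit Arguments.
Unset Strict Implicit.
Variables (F : fieldType) (V : lmodType F) (mul br : {bilinear V -> V -> V}).
Implicit Types (I : V -> Prop) (op : {bilinear V -> V -> V}).

Definition even_grading (a : bool) (x : V) := if a then x = 0 else True.

Lemma even_gradingP : grading even_grading.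
Proof.
split=> [[]|x|x _ //]; [exact: subspace_zero | by split |].
by exists x, 0; rewrite addr0.
Qed.

Lemma even_graded_op op : graded_op even_grading op.
Proof.
by move=> [] [] x y //= => [-> _|_ ->]; rewrite ?linear0l ?linear0r.
Qed.

Lemma even_graded_subspace I : graded_subspace even_grading I <-> subspace I.
Proof.
split=> [[]//|sI]; split=> // x Ix; exists x, 0; rewrite addr0.
by do ![split => //]; exact: subspace0.
Qed.

Lemma even_superP :
  transposed_poisson mul br -> transposed_poisson_super even_grading mul br.
Proof.
move=> [mulA mulC [brxx jacobi] rule].
have brC x y : br x y = - br y x.
  apply/eqP; rewrite -addr_eq0; have := brxx (x + y).
  by rewrite linearDl !linearDr !brxx add0r addr0 => ->.
split=> //.
- exact: even_graded_op.
- by move=> [] [] x y /= Gx Gy; rewrite ?expr0 ?scale1r // Gx Gy !linear0l scaler0.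
- split; [exact: even_gradingP | exact: even_graded_op | |].
  + move=> [] [] x y /= Gx Gy; rewrite ?expr0 ?scale1r //.
    by rewrite Gx Gy !linear0l scaler0 oppr0.
  + move=> [] [] [] x y z /= Gx Gy Gz; rewrite ?expr0 ?scale1r //;
    by rewrite ?Gx ?Gy ?Gz !(linear0l, linear0r, scaler0, addr0).
- move=> [] [] [] x y z /= Gx Gy Gz; rewrite ?expr0 ?scale1r //;
    by rewrite ?Gx ?Gy ?Gz !(linear0l, linear0r, scaler0, addr0, mul0rn).
Qed.

Lemma even_stp_simple : stp_simple even_grading mul br <-> tp_simple mul br.
Proof.
by split=> simpleP [I [sI pI mI bI]]; apply: simpleP; exists I; split=> //;
  apply/even_graded_subspace.
Qed.

Lemma even_slie_simple : slie_simple even_grading br <-> lie_simple br.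
Proof.
by split=> -[br0 simpleP]; split=> // -[I [sI pI bI]]; apply: simpleP;
  exists I; split=> //; apply/even_graded_subspace.
Qed.

End TrivialGrading.

Theorem mainTheorem1 (F : fieldType) (char_neq2 : 2%N \notin [pchar F]) :
  (forall (V : lmodType F) (mul br : {bilinear V -> V -> V}),
     transposed_poisson mul br -> nonzero_op br ->
     (tp_simple mul br <-> lie_simple br))
  /\
  (forall (V : lmodType F) (G : bool -> V -> Prop)
          (mul br : {bilinear V -> V -> V}),
     transposed_poisson_super G mul br -> nonzero_op br ->
     (stp_simple G mul br <-> slie_simple G br)).
Proof.
split=> [V mul br tpP br0|V G mul br tpP br0]; last exact: stp_simple_iff.
by rewrite -even_stp_simple -even_slie_simple; apply: stp_simple_iff => //;
  exact: even_superP.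
Qed.
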